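(* Assume $K_2=1$ in (A2), $r_k\ge4/7$ for all $k\ge2$, $\kappa\ge\|f'\|_{C[-\beta,\beta]}$, $\|\phi^0\|_\infty\le\beta$, and $$\tau_1\le\min\Big\{\Big(\frac{4}{11\varsigma m(\kappa+4\varepsilon^2/h^2)\Gamma(2-\alpha)}\Big)^{1/\alpha},\Big(\frac{4}{11\kappa(1-\varsigma)m\Gamma(2-\alpha)}\Big)^{1/\alpha}\Big\}.$$ Then the unbalanced $L2$-$1_\sigma$-sESAV scheme is energy-stable without further time-step size restriction: $\mathcal E_h[\phi^n,R^n]\le\mathcal E_h[\phi^0,R^0]$ for all $n\ge1$.
   Context: Setting: $\Omega=(0,L)^2$ with periodic boundary conditions; constants $m>0$, $\varepsilon>0$, $\alpha\in(0,1)$, and $\varsigma:=\alpha/2$. The nonlinearity $f=-F'$ is one of: (double-well) $F(\phi)=\frac14(1-\phi^2)^2$, $f(\phi)=\phi-\phi^3$, with $\beta=1$; or (Flory–Huggins) $F(\phi)=\frac{\theta}{2}[(1+\phi)\ln(1+\phi)+(1-\phi)\ln(1-\phi)]-\frac{\theta_c}{2}\phi^2$, $f(\phi)=\frac{\theta}{2}\ln\frac{1-\phi}{1+\phi}+\theta_c\phi$ on $(-1,1)$, with $\theta_c>\theta>0$ and $\beta\in(0,1)$ the positive root of $f$. In both cases $f(\pm\beta)=0$. Spatial discretization: $M\in\mathbb N$, $h=L/M$; $\mathbb V_h$ is the space of real grid functions $v=\{v_{ij}\}_{i,j\in\mathbb Z}$ that are $M$-periodic in each index; $\langle v,w\rangle=h^2\sum_{i,j=1}^Mv_{ij}w_{ij}$,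 $\|v\|=\sqrt{\langle v,v\rangle}$, $\|v\|_\infty=\max_{1\le i,j\le M}|v_{ij}|$; $\Delta_hv_{ij}=h^{-2}(v_{i+1,j}+v_{i-1,j}+v_{i,j+1}+v_{i,j-1}-4v_{ij})$; $\nabla_hv_{ij}=\big(\frac{v_{i+1,j}-v_{ij}}h,\frac{v_{i,j+1}-v_{ij}}h\big)$ and $\|\nabla_hv\|^2=h^2\sum_{i,j=1}^M|\nabla_hv_{ij}|^2$. Scalar functions act on grid functions pointwise. $E_{1h}[v]=\langle F(v),1\rangle$ and $g_h(v,w)=\exp(w)/\exp(E_{1h}[v])$ for $v\in\mathbb V_h$ (with $\|v\|_\infty<1$ in the Flory–Huggins case) and $w\in\mathbb R$. The discrete modified energy is $\mathcal E_h[\phi,R]=\frac{\varepsilon^2}{2}\|\nabla_h\phi\|^2+R$. Auxiliary functional: $V:\mathbb R\to\mathbb R$ satisfies (A1) $V\in C^1(\mathbb R)\cap W^{2,\infty}(\mathbb R)$, $V(1)=1$, $V'(1)=0$, $|V'|\le K_1$; (A2) $0\le V\le K_2$ for a constant $K_2>0$; (A3) $|z_1-1|\le|z_2-1|$ implies $|V(z_1)-1|\le|V(z_2)-1|$. Time grid: $0=t_0<t_1<\dots<t_N=T$, $\tau_k=t_k-t_{k-1}$, $r_k=\tau_k/\tau_{k-1}$ ($k\ge2$), $\nabla_\tau v^k=v^k-v^{k-1}$, $\mathbb D_\tau v^k=\nabla_\tau v^k/\tau_k$, $\omega_\mu(t)=t^{\mu-1}/\Gamma(\mu)$. Constant $\kappa\ge0$;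 data $\phi^0\in\mathbb V_h$, $R^0\in\mathbb R$. For $n\ge2$ the predicted solution is $\hat\phi^n=\min\{\max\{(1+r_n)\phi^{n-1}-r_n\phi^{n-2},-\beta\},\beta\}$ (pointwise). $L2$-$1_\sigma$ discretization: $t_{k-\varsigma}=(1-\varsigma)t_k+\varsigma t_{k-1}$, $t_{k-1/2}=(t_k+t_{k-1})/2$; $a^{(n)}_{n-k}=\frac1{\tau_k}\int_{t_{k-1}}^{\min\{t_k,t_{n-\varsigma}\}}\omega_{1-\alpha}(t_{n-\varsigma}-s)\,ds$ ($1\le k\le n$), $b^{(n)}_{n-k}=\frac{2}{\tau_k(\tau_k+\tau_{k+1})}\int_{t_{k-1}}^{t_k}(s-t_{k-1/2})\omega_{1-\alpha}(t_{n-\varsigma}-s)\,ds$ ($1\le k\le n-1$); $B^{(1)}_0=a^{(1)}_0$, and for $n\ge2$: $B^{(n)}_0=a^{(n)}_0+b^{(n)}_1/r_n$, $B^{(n)}_{n-k}=a^{(n)}_{n-k}+b^{(n)}_{n-k+1}/r_k-b^{(n)}_{n-k}$ for $2\le k\le n-1$, $B^{(n)}_{n-1}=a^{(n)}_{n-1}-b^{(n)}_{n-1}$; $\tilde{\mathbb D}^\alpha_\tau v^n=\sum_{k=1}^nB^{(n)}_{n-k}\nabla_\tau v^k$; $w^{k-\varsigma}=(1-\varsigma)w^k+\varsigma w^{k-1}$. Unbalanced $L2$-$1_\sigma$-sESAV scheme: $\hat\phi^1\in\mathbb V_h$ with $\|\hat\phi^1\|_\infty\le\beta$ solves $B^{(1)}_0(\hat\phi^1-\phi^0)=m(\varepsilon^2\Delta_h\hat\phi^{1-\varsigma}+f(\hat\phi^{1-\varsigma}))$;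 for $n\ge2$, $\hat\phi^n$ is the predicted solution above. For $n\ge1$ set $\hat\phi^{n-\varsigma}=(1-\varsigma)\hat\phi^n+\varsigma\phi^{n-1}$ and $V^{n-\varsigma}=V(g_h(\hat\phi^{n-\varsigma},R^{n-1}))$, and define $(\phi^n,R^n)$ by $\tilde{\mathbb D}^\alpha_\tau\phi^n=m(\varepsilon^2\Delta_h\phi^{n-\varsigma}+V^{n-\varsigma}f(\hat\phi^{n-\varsigma})-\kappa(\phi^{n-\varsigma}-V^{n-\varsigma}\hat\phi^{n-\varsigma}))$ and $\mathbb D_\tau R^n=-V^{n-\varsigma}\langle f(\hat\phi^{n-\varsigma}),\mathbb D_\tau\phi^n\rangle+\kappa\langle\phi^{n-\varsigma}-V^{n-\varsigma}\hat\phi^{n-\varsigma},\mathbb D_\tau\phi^n\rangle$. *)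

(* Defs.v *)
From HB Require Import structures.
From mathcomp Require Import all_boot all_order all_algebra.
From mathcomp Require Import all_classical all_reals all_analysis.
Set Implicit Arguments. Unset Strict Implicit. Unset Printing Implicit Defensive.
Import Order.TTheory GRing.Theory Num.Theory.
Import numFieldNormedType.Exports.
Local Open Scope classical_set_scope.
Local Open Scope ring_scope.

Section Defs.
Variable R : realType.

Definition Gamma (x : R) : R :=
  \int[(@lebesgue_measure R)]_(t in `]0%R, +oo[) (t `^ (x - 1) * expR (- t)).

Definition omega (mu t : R) : R := t `^ (mu - 1) / Gamma mu.

Inductive nonlin := DoubleWell | FloryHuggins of R & R (* theta, theta_c *).

Definition Fpot (nl : nonlin) (p : R) : R :=
  match nl with
  | DoubleWell => (1 - p ^+ 2) ^+ 2 / 4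
  | FloryHuggins th thc =>
      th / 2 * ((1 + p) * ln (1 + p) + (1 - p) * ln (1 - p)) - thc / 2 * p ^+ 2
  end.

Definition fnl (nl : nonlin) (p : R) : R :=
  match nl with
  | DoubleWell => p - p ^+ 3
  | FloryHuggins th thc => th / 2 * ln ((1 - p) / (1 + p)) + thc * p
  end.

Definition nonlin_ok (nl : nonlin) (beta : R) : Prop :=
  match nl with
  | DoubleWell => beta = 1
  | FloryHuggins th thc =>
      0 < th /\ th < thc /\ 0 < beta /\ beta < 1 /\ fnl nl beta = 0
  end.

Definition grid := int -> int -> R.

Definition grid_periodic (M : nat) (v : grid) : Prop :=
  forall i j : int, v (i + M%:Z) j = v i j /\ v i (j + M%:Z) = v i j.

Definition ip (M : nat) (h : R) (v w : grid) : R :=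
  h ^+ 2 * \sum_(1 <= i < M.+1) \sum_(1 <= j < M.+1) v i%:Z j%:Z * w i%:Z j%:Z.

Definition supn (M : nat) (v : grid) : R :=
  \big[Num.max/0]_(1 <= i < M.+1) \big[Num.max/0]_(1 <= j < M.+1) `|v i%:Z j%:Z|.

Definition lap (h : R) (v : grid) : grid := fun i j =>
  (v (i + 1) j + v (i - 1) j + v i (j + 1) + v i (j - 1) - 4 * v i j) / h ^+ 2.

Definition gradsq (M : nat) (h : R) (v : grid) : R :=
  h ^+ 2 * \sum_(1 <= i < M.+1) \sum_(1 <= j < M.+1)
    (((v (i%:Z + 1) j%:Z - v i%:Z j%:Z) / h) ^+ 2
     + ((v i%:Z (j%:Z + 1) - v i%:Z j%:Z) / h) ^+ 2).

Definition gmap (F : R -> R) (v : grid) : grid := fun i j => F (v i j).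
Definition gcomb (a : R) (v : grid) (b : R) (w : grid) : grid :=
  fun i j => a * v i j + b * w i j.
Definition one_grid : grid := fun _ _ => 1.

Definition E1h (nl : nonlin) (M : nat) (h : R) (v : grid) : R :=
  ip M h (gmap (Fpot nl) v) one_grid.

Definition gh (nl : nonlin) (M : nat) (h : R) (v : grid) (w : R) : R :=
  expR w / expR (E1h nl M h v).

Definition energy (M : nat) (h eps : R) (v : grid) (Rr : R) : R :=
  eps ^+ 2 / 2 * gradsq M h v + Rr.

Definition tau (t : nat -> R) (k : nat) : R := t k - t k.-1.
Definition tratio (t : nat -> R) (k : nat) : R := tau t k / tau t k.-1.
Definition tsig (t : nat -> R) (vs : R) (k : nat) : R := (1 - vs) * t k + vs * t k.-1.
Definition thalf (t : nat -> R) (k : nat) : R := (t k + t k.-1) / 2.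

(* a^(n)_(n-k), indexed by (n,k) *)
Definition acoef (alpha : R) (t : nat -> R) (n k : nat) : R :=
  let vs := alpha / 2 in
  (tau t k)^-1 * \int[(@lebesgue_measure R)]_(s in `[t k.-1, Num.min (t k) (tsig t vs n)])
     omega (1 - alpha) (tsig t vs n - s).

(* b^(n)_(n-k), indexed by (n,k) *)
Definition bcoef (alpha : R) (t : nat -> R) (n k : nat) : R :=
  let vs := alpha / 2 in
  2 / (tau t k * (tau t k + tau t k.+1)) *
  \int[(@lebesgue_measure R)]_(s in `[t k.-1, t k])
     ((s - thalf t k) * omega (1 - alpha) (tsig t vs n - s)).

(* B^(n)_(n-k), indexed by (n,k), 1 <= k <= n *)
Definition Bcoef (alpha : R) (t : nat -> R) (n k : nat) : R :=
  if n == 1%N then acoef alpha t 1 1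
  else if k == n then acoef alpha t n n + bcoef alpha t n n.-1 / tratio t n
  else if k == 1%N then acoef alpha t n 1 - bcoef alpha t n 1
  else acoef alpha t n k + bcoef alpha t n k.-1 / tratio t k - bcoef alpha t n k.

Definition Dfrac (alpha : R) (t : nat -> R) (v : nat -> grid) (n : nat) : grid :=
  fun i j => \sum_(1 <= k < n.+1) Bcoef alpha t n k * (v k i j - v k.-1 i j).

Definition clamp (beta x : R) : R := Num.min (Num.max x (- beta)) beta.

Definition phihat (t : nat -> R) (beta : R) (phi : nat -> grid) (ph1 : grid)
  (n : nat) : grid :=
  if n == 1%N then ph1
  else fun i j => clamp beta ((1 + tratio t n) * phi n.-1 i j - tratio t n * phi n.-2 i j).

End Defs.

(* Main.v *)
Require Import Defs.
From HB Require Import structures.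
From mathcomp Require Import all_boot all_order all_algebra.
From mathcomp Require Import all_classical all_reals all_analysis.
From mathcomp Require Import zify measurable_realfun ring lra.
Set Implicit Arguments. Unset Strict Implicit. Unset Printing Implicit Defensive.
Import Order.TTheory GRing.Theory Num.Theory.
Import numFieldNormedType.Exports.
Local Open Scope classical_set_scope.
Local Open Scope ring_scope.

(* Testing the scheme with x_n = phi^n - phi^(n-1), the nonlinear and the
   stabilization terms cancel against the equation for R^n, and vs <= 1/2 gives
   E^n - E^(n-1) <= - <D phi^n, x_n> / m.  So it suffices that the quadratic form
   Q = sum_{k <= n} B_{n,k} x_k x_n is nonnegative at every grid point.

   With d_{n,a} = B_{n,a} - B_{n,a-1} for a < n and d_{n,n} = 2 B_{n,n} - B_{n,n-1},
   two summations by parts write 2 Q as a combination of the squares of the block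
   sums x_a + ... + x_n with coefficients d_{n,a} and d_{n,a} - d_{n+1,a}, so it
   suffices that d is nonnegative and nonincreasing in n.

   For a < n, d_{n,a} is one functional, independent of n, applied to the kernel
   s |-> (t_{n-vs} - s)^(-alpha); it is nonnegative on nonnegative, nondecreasing,
   convex functions, and both the kernels and their consecutive differences in n
   are such functions.  The diagonal case only needs in addition the value of the
   integral of the singular kernel over [t_{n-1}, t_{n-vs}].  Of Gamma, only the
   sign matters. *)

(** * Quadratic forms of discrete convolution kernels *)

(** Each [b k] is the telescoping sum of its increments; exchanging the two sums collects the [x i]
    with [i >= a]. *)
Lemma abel_summation (R : comRingType) (b x : nat -> R) n : b 0%N = 0 ->
  \sum_(1 <= k < n.+1) b k * x k =
  \sum_(1 <= a < n.+1) (b a - b a.-1) * \sum_(a <= i < n.+1) x i.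
Proof.
move=> b0; have tel m : \sum_(1 <= a < m.+1) (b a - b a.-1) = b m.
  elim: m => [|m IH]; first by rewrite big_geq.
  by rewrite big_nat_recr //= IH; ring.
elim: n => [|n IH]; first by rewrite !big_geq.
rewrite big_nat_recr //= IH [RHS]big_nat_recr //= big_nat1.
rewrite [in RHS](eq_big_nat _ _ (F2 := fun a => (b a - b a.-1) * \sum_(a <= i < n.+1) x i
   + (b a - b a.-1) * x n.+1)); last first.
  by move=> a /andP[_ /ltnW an]; rewrite big_nat_recr /= ?mulrDr.
by rewrite big_split /= -mulr_suml tel; ring.
Qed.

(** Increments along the rows of the symmetrized matrix, whose diagonal is [2 * B n n]; hence the
    factor 2 when [a == n]. *)
Definition kernel_diff (R : ringType) (B : nat -> nat -> R) (n a : nat) : R :=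
  if a == n then 2 * B n n - B n n.-1 else B n a - B n a.-1.

Lemma kernel_form_ge0 (R : realDomainType) (B : nat -> nat -> R) (x : nat -> R)
    (N : nat) :
  (forall n, B n 0%N = 0) ->
  (forall n a, (1 <= a <= n)%N -> (n <= N)%N -> 0 <= kernel_diff B n a) ->
  (forall n a, (1 <= a <= n)%N -> (n < N)%N ->
     kernel_diff B n.+1 a <= kernel_diff B n a) ->
  forall n, (n <= N)%N ->
  0 <= \sum_(1 <= l < n.+1) (\sum_(1 <= k < l.+1) B l k * x k) * x l.
Proof.
move=> B0 d_ge0 d_le.
pose Y a n : R := \sum_(a <= i < n.+1) x i.
pose Q n : R := \sum_(1 <= l < n.+1) (\sum_(1 <= k < l.+1) B l k * x k) * x l.
(* The bound keeps the squares of all block sums ending at [n], so that the next step can trade each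
   one for its successor. *)
have main n : (n <= N)%N ->
    \sum_(1 <= a < n.+1) kernel_diff B n a * Y a n ^+ 2 <= 2 * Q n.
  elim: n => [_|n IH nN]; first by rewrite /Q !big_geq // mulr0.
  (* Since [Y a n.+1 = Y a n + x n.+1], the change of the squares produces the cross terms of the
     new row, and the coefficients of [x n.+1 ^+ 2] add up to [2 * B n.+1 n.+1]. *)
  have -> : 2 * Q n.+1 = 2 * Q n
      - \sum_(1 <= a < n.+1) kernel_diff B n.+1 a * Y a n ^+ 2
      + \sum_(1 <= a < n.+2) kernel_diff B n.+1 a * Y a n.+1 ^+ 2.
    have tel : \sum_(1 <= a < n.+1) (B n.+1 a - B n.+1 a.-1) = B n.+1 n.
      (* Against the indicator of [n] every block sum equals 1. *)
      have := @abel_summation R (B n.+1) (fun k => (k == n)%:R) n (B0 _).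
      have [->|n0] := posnP n; first by rewrite !big_geq.
      rewrite big_nat_recr //= eqxx mulr1 big_nat big1 ?add0r; last first.
        by move=> i /andP[_ /ltn_eqF ->]; rewrite mulr0.
      move=> ->; apply: eq_big_nat => a /andP[a0 an].
      rewrite big_nat_recr //= eqxx big_nat big1 ?add0r ?mulr1 //.
      by move=> i /andP[_ /ltn_eqF ->].
    have -> : Q n.+1 = Q n + (\sum_(1 <= k < n.+2) B n.+1 k * x k) * x n.+1.
      by rewrite /Q big_nat_recr.
    rewrite (abel_summation x n.+1 (B0 n.+1)) (big_nat_recr n.+1) //=.
    rewrite [X in _ = _ + X](big_nat_recr n.+1) //=.
    rewrite /kernel_diff eqxx.
    have YE a : (a <= n.+1)%N -> Y a n.+1 = Y a n + x n.+1.
      by move=> an; rewrite /Y big_nat_recr.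
    have Yn : Y n.+1 n.+1 = x n.+1 by rewrite /Y big_nat1.
    rewrite -/(Y n.+1 n.+1) Yn.
    rewrite (eq_big_nat _ _ (F1 := fun a => _ * \sum_(a <= i < n.+2) x i)
      (F2 := fun a => (B n.+1 a - B n.+1 a.-1) * Y a n
       + (B n.+1 a - B n.+1 a.-1) * x n.+1)); last first.
      by move=> a /andP[_ an]; rewrite -/(Y a n.+1) YE ?mulrDr // ltnW.
    rewrite big_split /= -mulr_suml tel.
    rewrite (eq_big_nat _ _ (F1 := fun a => _ * Y a n ^+ 2)
      (F2 := fun a => (B n.+1 a - B n.+1 a.-1) * Y a n ^+ 2)); last first.
      by move=> a /andP[_ an]; rewrite ltn_eqF.
    rewrite (eq_big_nat _ _ (F1 := fun a => _ * Y a n.+1 ^+ 2)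
      (F2 := fun a => (B n.+1 a - B n.+1 a.-1) * Y a n ^+ 2
       + (2 * x n.+1) * ((B n.+1 a - B n.+1 a.-1) * Y a n)
       + (B n.+1 a - B n.+1 a.-1) * x n.+1 ^+ 2)); last first.
      move=> a /andP[_ an]; rewrite ltn_eqF // YE ?(ltnW an) //; ring.
    rewrite !big_split /= -mulr_sumr -mulr_suml tel; ring.
  (* The old squares now carry the weights of row [n.+1], which do not exceed those of row [n]. *)
  rewrite lerDr subr_ge0; apply: le_trans (IH (ltnW nN)).
  apply: ler_sum_nat => a /andP[a0 an]; apply: ler_wpM2r; first exact: sqr_ge0.
  by apply: d_le => //; rewrite a0.
move=> n nN; rewrite -(pmulr_rge0 _ (ltr0Sn R 1)); apply: le_trans (main n nN).
rewrite big_nat; apply: sumr_ge0 => a /andP[a0 an].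
by rewrite mulr_ge0 ?sqr_ge0 ?d_ge0 // a0.
Qed.

(** * Discrete energy estimate *)

Lemma sum_shift_periodic (R : zmodType) (M : nat) (u : int -> R) :
  (forall i, u (i + M%:Z) = u i) ->
  \sum_(1 <= i < M.+1) u (i%:Z + 1) = \sum_(1 <= i < M.+1) u i%:Z.
Proof.
move=> uM; have [->|M0] := posnP M; first by rewrite !big_geq.
have -> : \sum_(1 <= i < M.+1) u (i%:Z + 1) = \sum_(2 <= i < M.+2) u i%:Z.
  by rewrite [RHS]big_add1; apply: eq_bigr => i _; rewrite -addn1 PoszD.
rewrite big_nat_recr //= [RHS]big_ltn // [RHS]addrC; congr +%R.
by rewrite -(uM 1) -addn1 PoszD addrC.
Qed.

Lemma sum_by_parts_periodic (R : comRingType) (M : nat) (v w : int -> R) :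
  (forall i, v (i + M%:Z) = v i) -> (forall i, w (i + M%:Z) = w i) ->
  \sum_(1 <= i < M.+1) (v (i%:Z + 1) + v (i%:Z - 1) - 2 * v i%:Z) * w i%:Z =
  - \sum_(1 <= i < M.+1) (v (i%:Z + 1) - v i%:Z) * (w (i%:Z + 1) - w i%:Z).
Proof.
(* [P] is a discrete flux: the two summands add up to [P (i + 1) - P i], whose sum over a period
   vanishes. *)
move=> vM wM; pose P i := (v i - v (i - 1)) * w i.
apply/eqP; rewrite -addr_eq0 -big_split /=; apply/eqP.
rewrite (eq_bigr (fun i : nat => P (i%:Z + 1) - P i%:Z)); last first.
  by move=> i _; rewrite /P addrK; ring.
rewrite sumrB sum_shift_periodic ?subrr // => i.
by rewrite /P wM vM addrAC vM.
Qed.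

Section Grid.
Variables (R : realType) (M : nat) (h : R).
Implicit Types v w : grid R.

Lemma ip_gcombl a v b v' w :
  ip M h (gcomb a v b v') w = a * ip M h v w + b * ip M h v' w.
Proof.
rewrite /ip mulrCA [b * _]mulrCA -mulrDr; congr (_ * _).
rewrite !mulr_sumr -big_split; apply: eq_bigr => i _ /=.
rewrite !mulr_sumr -big_split; apply: eq_bigr => j _ /=.
by rewrite /gcomb; ring.
Qed.

Lemma ip_scaler v a w : ip M h v (fun i j => w i j * a) = ip M h v w * a.
Proof.
rewrite /ip -mulrA; congr (_ * _); rewrite mulr_suml; apply: eq_bigr => i _.
by rewrite mulr_suml; apply: eq_bigr => j _; rewrite mulrA.
Qed.

Lemma ip_lap v w : grid_periodic M v -> grid_periodic M w ->
  ip M h (lap h v) w = - (h ^+ 2 * \sum_(1 <= i < M.+1) \sum_(1 <= j < M.+1)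
    ((v (i%:Z + 1) j%:Z - v i%:Z j%:Z) / h * ((w (i%:Z + 1) j%:Z - w i%:Z j%:Z) / h)
   + (v i%:Z (j%:Z + 1) - v i%:Z j%:Z) / h * ((w i%:Z (j%:Z + 1) - w i%:Z j%:Z) / h))).
Proof.
move=> pv pw; rewrite /ip -mulrN; congr (_ * _).
(* The five-point stencil is a sum of two second differences; each direction is summed by parts
   separately. *)
pose X := \sum_(1 <= i < M.+1) \sum_(1 <= j < M.+1)
  (v (i%:Z + 1) j%:Z + v (i%:Z - 1) j%:Z - 2 * v i%:Z j%:Z) * w i%:Z j%:Z.
pose Y := \sum_(1 <= i < M.+1) \sum_(1 <= j < M.+1)
  (v i%:Z (j%:Z + 1) + v i%:Z (j%:Z - 1) - 2 * v i%:Z j%:Z) * w i%:Z j%:Z.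
have EX : X = - \sum_(1 <= i < M.+1) \sum_(1 <= j < M.+1)
   (v (i%:Z + 1) j%:Z - v i%:Z j%:Z) * (w (i%:Z + 1) j%:Z - w i%:Z j%:Z).
  rewrite /X exchange_big [in RHS]exchange_big -sumrN; apply: eq_bigr => j _ /=.
  by apply: (@sum_by_parts_periodic _ M (v^~ j%:Z) (w^~ j%:Z)) => i;
    [case: (pv i j)|case: (pw i j)].
have EY : Y = - \sum_(1 <= i < M.+1) \sum_(1 <= j < M.+1)
   (v i%:Z (j%:Z + 1) - v i%:Z j%:Z) * (w i%:Z (j%:Z + 1) - w i%:Z j%:Z).
  rewrite /Y -sumrN; apply: eq_bigr => i _ /=.
  by apply: (@sum_by_parts_periodic _ M (v i%:Z) (w i%:Z)) => j;
    [case: (pv i j)|case: (pw i j)].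
transitivity ((X + Y) * (h ^+ 2)^-1).
  rewrite /X /Y -big_split /= mulr_suml; apply: eq_bigr => i _.
  rewrite -big_split /= mulr_suml; apply: eq_bigr => j _.
  by rewrite /lap; ring.
rewrite EX EY -opprD -big_split /= mulNr mulr_suml; congr (- _).
apply: eq_bigr => i _; rewrite -big_split /= mulr_suml.
by apply: eq_bigr => j _; rewrite -exprVn; ring.
Qed.

(* With weight [1 - vs >= 1/2] on the new level, [<grad ps, grad (v - u)>]
   exceeds [(|grad v|^2 - |grad u|^2) / 2] by [(1/2 - vs) |grad (v - u)|^2]. *)
Lemma ip_lap_weighted_le (vs : R) v u : vs <= 1 / 2 ->
  grid_periodic M v -> grid_periodic M u ->
  ip M h (lap h (gcomb (1 - vs) v vs u)) (gcomb 1 v (-1) u) <=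
  - ((gradsq M h v - gradsq M h u) / 2).
Proof.
move=> vs2 pv pu.
have pc a b : grid_periodic M (gcomb a v b u).
  by move=> i j; rewrite /gcomb; case: (pv i j) => -> ->; case: (pu i j) => -> ->.
rewrite ip_lap // lerN2 /gradsq -mulrBr -mulrA; apply: ler_wpM2l.
  exact: sqr_ge0.
rewrite -sumrB mulr_suml; apply: ler_sum => i _.
rewrite -sumrB mulr_suml; apply: ler_sum => j _; rewrite /gcomb.
have key (a b : R) : (a ^+ 2 - b ^+ 2) / 2 <= ((1 - vs) * a + vs * b) * (a - b).
  rewrite -subr_ge0 (_ : _ - _ = (1 / 2 - vs) * (a - b) ^+ 2); last by field.
  by rewrite mulr_ge0 ?sqr_ge0 ?subr_ge0.
set a1 := v (i%:Z + 1) _; set a2 := v i _; set a3 := v i (_ + _).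
set b1 := u (i%:Z + 1) _; set b2 := u i _; set b3 := u i (_ + _).
have := lerD (key ((a1 - a2) / h) ((b1 - b2) / h)) (key ((a3 - a2) / h) ((b3 - b2) / h)).
by congr (_ <= _); ring.
Qed.

End Grid.

(** [Vs n] and [phs n] enter both equations in the same way and cancel, so their values can stay
    arbitrary here. *)
Lemma energy_le_of_form_ge0 (R : realType) (M N : nat) (h m eps vs kappa : R)
  (t : nat -> R) (phi phs : nat -> grid R) (Vs : nat -> R) (Rv : nat -> R)
  (f : R -> R) (B : nat -> nat -> R) :
  0 < m -> vs <= 1 / 2 -> (forall n, grid_periodic M (phi n)) ->
  (forall n, (1 <= n <= N)%N -> tau t n != 0) ->
  (forall n, (1 <= n <= N)%N ->
     let ps := gcomb (1 - vs) (phi n) vs (phi n.-1) in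
     let Dphi : grid R := fun i j => (phi n i j - phi n.-1 i j) / tau t n in
     (forall i j, \sum_(1 <= k < n.+1) B n k * (phi k i j - phi k.-1 i j)
        = m * (eps ^+ 2 * lap h ps i j + Vs n * f (phs n i j)
               - kappa * (ps i j - Vs n * phs n i j))) /\
     (Rv n - Rv n.-1) / tau t n
        = - Vs n * ip M h (gmap f (phs n)) Dphi
          + kappa * ip M h (gcomb 1 ps (- Vs n) (phs n)) Dphi) ->
  (forall x n, (n <= N)%N -> 0 <= \sum_(1 <= l < n.+1)
     (\sum_(1 <= k < l.+1) B l k * x k) * x l) ->
  forall n, (n <= N)%N ->
    energy M h eps (phi n) (Rv n) <= energy M h eps (phi 0%N) (Rv 0%N).
Proof.
move=> m0 vs2 per tau0 sch pos n nN.
pose D l : grid R := gcomb 1 (phi l) (-1) (phi l.-1).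
pose L l : grid R := fun i j =>
  \sum_(1 <= k < l.+1) B l k * (phi k i j - phi k.-1 i j).
have step l : (1 <= l <= N)%N -> energy M h eps (phi l) (Rv l) <=
    energy M h eps (phi l.-1) (Rv l.-1) - m^-1 * ip M h (L l) (D l).
  move=> lN; have [/= Leq Req] := sch l lN.
  set ps := gcomb (1 - vs) _ _ _ in Leq Req.
  have LE : L l = gcomb (m * eps ^+ 2) (lap h ps) 1
      (gcomb (m * Vs l) (gmap f (phs l)) (- (m * kappa)) (gcomb 1 ps (- Vs l) (phs l))).
    apply/funext => i; apply/funext => j.
    by rewrite /L Leq /gcomb /gmap; ring.
  have DE : (fun i j => (phi l i j - phi l.-1 i j) / tau t l) =
      (fun i j => D l i j * (tau t l)^-1).
    by apply/funext => i; apply/funext => j; rewrite /D /gcomb mul1r mulN1r.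
  have {}Req : Rv l - Rv l.-1 = - Vs l * ip M h (gmap f (phs l)) (D l)
      + kappa * ip M h (gcomb 1 ps (- Vs l) (phs l)) (D l).
    rewrite -[LHS](divfK (tau0 l lN)) Req DE !ip_scaler.
    by field; exact: tau0.
  rewrite LE 2!ip_gcombl.
  have := ip_lap_weighted_le h vs2 (per l) (per l.-1).
  rewrite -/ps -/(D l) => le.
  have {}le := ler_wpM2l (sqr_ge0 eps) le.
  rewrite /energy.
  set A := ip M h (lap h ps) (D l) in le *.
  set F := ip M h (gmap f _) _ in Req *.
  set G := ip M h (gcomb 1 ps _ _) _ in Req *.
  (* The terms in [F] and [G] are now exactly [- (Rv l - Rv l.-1)] from [Req]; [A] is bounded by the
     gradient energies. *)
  have -> : m^-1 * (m * eps ^+ 2 * A + 1 * (m * Vs l * F + - (m * kappa) * G)) =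
     eps ^+ 2 * A + Vs l * F - kappa * G by field; rewrite gt_eqF.
  lra.
have sumstep : energy M h eps (phi n) (Rv n) <= energy M h eps (phi 0%N) (Rv 0%N)
    - m^-1 * \sum_(1 <= l < n.+1) ip M h (L l) (D l).
  elim: n nN => [|n IH] nN; first by rewrite big_geq // mulr0 subr0.
  rewrite big_nat_recr //= mulrDr opprD addrA.
  apply: le_trans (step n.+1 _) _; first by rewrite nN.
  by rewrite lerD2r IH // ltnW.
apply: le_trans sumstep _; rewrite gerBl mulr_ge0 ?invr_ge0 ?(ltW m0) //.
(* With the time sum innermost, each grid point carries the quadratic form of the increments of
   [phi] there. *)
rewrite -mulr_sumr mulr_ge0 ?sqr_ge0 // exchange_big /=.
apply: sumr_ge0 => i _; rewrite exchange_big /=; apply: sumr_ge0 => j _.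
have := pos (fun k => phi k i%:Z j%:Z - phi k.-1 i%:Z j%:Z) n nN.
congr (_ <= _); apply: eq_bigr => l _.
by rewrite /D /gcomb mul1r mulN1r.
Qed.

(** * Integrals of convex nondecreasing functions *)

Section Basics.
Variable R : realType.
Notation mu := (@lebesgue_measure R).
Implicit Types (a b c : R) (F G dG : R -> R).

Lemma pointwise_continuous_integrable a b G :
  (forall s, a <= s <= b -> {for s, continuous G}) ->
  mu.-integrable `[a, b] (EFin \o G).
Proof.
move=> cG; apply: continuous_compact_integrable; first exact: segment_compact.
by apply: continuous_in_subspaceT => s; rewrite inE /= in_itv; exact: cG.
Qed.

Lemma is_derive_continuous (s d : R) G : is_derive s 1 G d -> {for s, continuous G}.
Proof. by case=> /derivable1_diffP dG _; exact: differentiable_continuous. Qed.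

Lemma integral_FTC2 a b F G : a < b ->
  (forall s, a <= s <= b -> {for s, continuous G}) ->
  (forall s, a <= s <= b -> is_derive s 1 F (G s)) ->
  (\int[mu]_(s in `[a, b]) (G s)%:E = (F b - F a)%:E)%E.
Proof.
move=> ab cG dF; have cF s : a <= s <= b -> {for s, continuous F}.
  by move=> /dF; exact: is_derive_continuous.
rewrite (@continuous_FTC2 _ G F) ?EFinB //.
- by apply: continuous_in_subspaceT => s; rewrite inE /= in_itv; exact: cG.
- split.
  + move=> s; rewrite in_itv /= => /andP[/ltW sa /ltW sb].
    by have [] : is_derive s 1 F (G s) by apply: dF; rewrite sa.
  + by apply: cvg_at_right_filter; apply: cF; rewrite lexx ltW.
  + by apply: cvg_at_left_filter; apply: cF; rewrite lexx ltW.
- move=> s; rewrite in_itv /= => /andP[sa sb]; rewrite derive1E.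
  by apply: derive_val; apply: dF; rewrite !ltW.
Qed.

Lemma Rintegral_FTC2 a b F G : a < b ->
  (forall s, a <= s <= b -> {for s, continuous G}) ->
  (forall s, a <= s <= b -> is_derive s 1 F (G s)) ->
  \int[mu]_(s in `[a, b]) G s = F b - F a.
Proof. by move=> ab cG dF; rewrite /Rintegral (integral_FTC2 ab cG dF). Qed.

Lemma mean_value a b F dF : a <= b ->
  (forall s, a <= s <= b -> is_derive s 1 F (dF s)) ->
  exists2 c, a <= c <= b & F b - F a = dF c * (b - a).
Proof.
move=> ab h; have [||c] := @MVT_segment R F dF a b ab.
- by move=> s; rewrite in_itv /= => /andP[sa sb]; apply: h; rewrite !ltW.
- apply: continuous_in_subspaceT => s; rewrite inE /= in_itv /= => /h.
  exact: is_derive_continuous.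
by rewrite in_itv /= => ? ?; exists c.
Qed.

End Basics.

(** [dG] is an argument because the bounds use its values; [c] stands for the singularity of the
    power kernel, hence [s < c]. *)
Definition convex_nondecreasing (R : realType) (c : R) (G dG : R -> R) :=
  [/\ forall s, s < c -> is_derive s 1 G (dG s),
      forall s, s < c -> 0 <= dG s &
      forall s s', s <= s' -> s' < c -> dG s <= dG s'].

(** The integral in [bcoef], with the endpoints added in the order of [thalf]. *)
Definition moment (R : realType) (a b : R) (G : R -> R) : R :=
  \int[lebesgue_measure]_(s in `[a, b]) ((s - (b + a) / 2) * G s).

Section Convex.
Variables (R : realType) (c : R) (G dG : R -> R).
Hypothesis cvxG : convex_nondecreasing c G dG.
Notation mu := (@lebesgue_measure R).
Implicit Types a b p q s : R.

Lemma convex_nondecreasing_continuous a b : b < c ->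
  forall s, a <= s <= b -> {for s, continuous G}.
Proof.
case: cvxG => dG_ _ _ bc s /andP[_ sb].
by apply: is_derive_continuous; apply: dG_; exact: le_lt_trans bc.
Qed.

Lemma moment_continuous a b : b < c ->
  forall s, a <= s <= b -> {for s, continuous (fun s => (s - (b + a) / 2) * G s)}.
Proof.
move=> bc s sab; apply: continuousM; last exact: convex_nondecreasing_continuous sab.
by apply: continuousB; [exact: cvg_id|exact: cst_continuous].
Qed.

Lemma convex_nondecreasing_le a b : a <= b -> b < c -> G a <= G b.
Proof.
case: cvxG => dG_ dG0 _ ab bc.
have [|x /andP[_ xb] e] := @mean_value R a b G dG ab.
  by move=> s /andP[_ sb]; apply: dG_; exact: le_lt_trans bc.
by rewrite -subr_ge0 e mulr_ge0 ?subr_ge0 // dG0 // (le_lt_trans xb).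
Qed.

Lemma convex_slope_le a b p : a <= b -> b <= p -> p < c ->
  G b - G a <= dG p * (b - a).
Proof.
case: cvxG => dG_ dG0 dGm ab bp pc.
have [|x /andP[_ xb] ->] := @mean_value R a b G dG ab.
  by move=> s /andP[_ sb]; apply: dG_; rewrite (le_lt_trans sb) // (le_lt_trans bp).
by rewrite ler_wpM2r ?subr_ge0 // dGm // (le_trans xb).
Qed.

Lemma convex_slope_ge a b p : a <= b -> p <= a -> b < c ->
  dG p * (b - a) <= G b - G a.
Proof.
case: cvxG => dG_ dG0 dGm ab pa bc.
have [|x /andP[ax xb] ->] := @mean_value R a b G dG ab.
  by move=> s /andP[_ sb]; apply: dG_; rewrite (le_lt_trans sb).
by rewrite ler_wpM2r ?subr_ge0 // dGm // ?(le_trans pa) // (le_lt_trans xb).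
Qed.

(** Evaluates the polynomials, centred at a midpoint or an endpoint, with which the integrands below
    are compared. *)
Lemma Rintegral_quadratic a b (m x y z : R) : a < b ->
  let f s := x + y * (s - m) + z * (s - m) ^+ 2 in
  (forall s, {for s, continuous f}) /\
  \int[mu]_(s in `[a, b]) f s =
    x * (b - a) + y * ((b - m) ^+ 2 - (a - m) ^+ 2) / 2
    + z * ((b - m) ^+ 3 - (a - m) ^+ 3) / 3.
Proof.
move=> ab f.
pose F s := x * s + y / 2 * (s - m) ^+ 2 + z / 3 * (s - m) ^+ 3.
have dF (u : R) : is_derive u 1 F (f u).
  by apply: is_derive_eq; rewrite /f /GRing.scale /=; field.
have cf (u : R) : {for u, continuous f}.
  have : is_derive u 1 f (y + z * 2 * (u - m)).
    by apply: is_derive_eq; rewrite /GRing.scale /=; ring.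
  exact: is_derive_continuous.
by split => //; rewrite (@Rintegral_FTC2 _ a b F f) // /F; field.
Qed.

(** As [s - m] integrates to zero, [G] may be replaced by [G - G m], which has the sign of
    [s - m]. *)
Lemma moment_ge0 a b : a < b -> b < c -> 0 <= moment a b G.
Proof.
move=> ab bc; set m := (b + a) / 2.
have [cf If] := @Rintegral_quadratic a b m 0 (G m) 0 ab.
have -> : 0 = \int[mu]_(s in `[a, b]) (0 + G m * (s - m) + 0 * (s - m) ^+ 2).
  by rewrite If /m; field.
apply: le_Rintegral => //; [exact: pointwise_continuous_integrable|
  by apply: pointwise_continuous_integrable; exact: moment_continuous|].
move=> s /=; rewrite in_itv /= => /andP[sa sb].
rewrite add0r mul0r addr0 -/m [leRHS]mulrC -subr_ge0 -mulrBl.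
have mb : m <= b by rewrite /m; lra.
have [sm|/ltW ms] := leP s m.
  have := convex_nondecreasing_le sm (le_lt_trans mb bc); nra.
have := convex_nondecreasing_le ms (le_lt_trans sb bc); nra.
Qed.

(** After subtracting [G m], the integrand is at most [dG b * (s - m) ^+ 2], and the square
    integrates to [(b - a) ^+ 3 / 12]. *)
Lemma moment_le a b : a < b -> b < c -> moment a b G <= dG b * (b - a) ^+ 3 / 12.
Proof.
move=> ab bc; set m := (b + a) / 2.
have [cf If] := @Rintegral_quadratic a b m 0 (G m) (dG b) ab.
have -> : dG b * (b - a) ^+ 3 / 12 =
    \int[mu]_(s in `[a, b]) (0 + G m * (s - m) + dG b * (s - m) ^+ 2).
  by rewrite If /m; field.
apply: le_Rintegral => //; [
  by apply: pointwise_continuous_integrable; exact: moment_continuous|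
  exact: pointwise_continuous_integrable|].
move=> s /=; rewrite in_itv /= => /andP[sa sb]; rewrite -/m.
have mb : m <= b by rewrite /m; lra.
have [sm|/ltW ms] := leP s m.
  have := convex_slope_le sm mb bc; nra.
have := convex_slope_le ms sb bc; nra.
Qed.

(** By convexity [G] lies below the line through [(b, G b)] with the smallest slope, [dG a]. *)
Lemma Rintegral_convex_le a b : a < b -> b < c ->
  \int[mu]_(s in `[a, b]) G s <= (b - a) * G b - dG a * (b - a) ^+ 2 / 2.
Proof.
move=> ab bc.
have [cf If] := @Rintegral_quadratic a b b (G b) (dG a) 0 ab.
have -> : (b - a) * G b - dG a * (b - a) ^+ 2 / 2 =
    \int[mu]_(s in `[a, b]) (G b + dG a * (s - b) + 0 * (s - b) ^+ 2).
  by rewrite If; field.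
apply: le_Rintegral => //; [
  by apply: pointwise_continuous_integrable; exact: convex_nondecreasing_continuous|
  exact: pointwise_continuous_integrable|].
move=> s /=; rewrite in_itv /= => /andP[sa sb].
have := convex_slope_ge sb sa bc; lra.
Qed.

Lemma Rintegral_nondecreasing_ge a b : a < b -> b < c ->
  (b - a) * G a <= \int[mu]_(s in `[a, b]) G s.
Proof.
move=> ab bc.
have [cf If] := @Rintegral_quadratic a b b (G a) 0 0 ab.
have -> : (b - a) * G a =
    \int[mu]_(s in `[a, b]) (G a + 0 * (s - b) + 0 * (s - b) ^+ 2).
  by rewrite If; field.
apply: le_Rintegral => //; [
  exact: pointwise_continuous_integrable|
  by apply: pointwise_continuous_integrable; exact: convex_nondecreasing_continuous|].
move=> s /=; rewrite in_itv /= => /andP[sa sb].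
by rewrite !mul0r !addr0 convex_nondecreasing_le // (le_lt_trans sb).
Qed.

(** The integrands differ by the product of [b - s] and [G s - G a], both nonnegative. *)
Lemma moment_le_Rintegral a b : a < b -> b < c ->
  moment a b G <= (b - a) / 2 * (\int[mu]_(s in `[a, b]) G s - (b - a) * G a).
Proof.
move=> ab bc; set m := (b + a) / 2.
have iG : mu.-integrable `[a, b] (EFin \o G).
  by apply: pointwise_continuous_integrable; exact: convex_nondecreasing_continuous.
have [cf If] := @Rintegral_quadratic a b m (- (b - a) / 2 * G a) (G a) 0 ab.
have iH : mu.-integrable `[a, b] (EFin \o (fun s => (b - a) / 2 * G s)).
  apply: pointwise_continuous_integrable => s sab.
  by apply: continuousM; [exact: cst_continuous|exact: convex_nondecreasing_continuous sab].
have -> : (b - a) / 2 * (\int[mu]_(s in `[a, b]) G s - (b - a) * G a) =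
    \int[mu]_(s in `[a, b]) ((b - a) / 2 * G s +
      (- (b - a) / 2 * G a + G a * (s - m) + 0 * (s - m) ^+ 2)).
  rewrite RintegralD //; last exact: pointwise_continuous_integrable.
  by rewrite RintegralZl // If /m; field.
apply: le_Rintegral => //.
- by apply: pointwise_continuous_integrable; exact: moment_continuous.
- apply: pointwise_continuous_integrable => s sab; apply: continuousD => //.
  by apply: continuousM; [exact: cst_continuous|exact: convex_nondecreasing_continuous sab].
move=> s /=; rewrite in_itv /= => /andP[sa sb]; rewrite -/m.
have le := convex_nondecreasing_le sa (le_lt_trans sb bc).
rewrite -subr_ge0 (_ : _ - _ = (b - s) * (G s - G a)); last by rewrite /m; field.
by rewrite mulr_ge0 // subr_ge0.
Qed.

End Convex.

(** * Power kernels *)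

Section PowerKernel.
Variable R : realType.
Notation mu := (@lebesgue_measure R).
Implicit Types (a b c p s : R).

Lemma is_derive_powR_reflect c p s : s < c ->
  is_derive s 1 (fun u : R => (c - u) `^ p) (- p * (c - s) `^ (p - 1)).
Proof.
move=> sc; have cs : 0 < c - s by rewrite subr_gt0.
have d1 : is_derive (c - s) 1 (fun x : R => x `^ p) (p * (c - s) `^ (p - 1)).
  exact: is_derive1_powR.
have d2 : is_derive s 1 (fun u : R => c - u) (- 1).
  by apply: is_derive_eq; ring.
have := @is_derive1_comp R (fun x : R => x `^ p) (fun u => c - u) s _ _ d1 d2.
by rewrite mulrN1 mulNr.
Qed.

Lemma le_powR_neg p : 0 <= p -> forall x y : R, 0 < x -> x <= y ->
  y `^ (- p) <= x `^ (- p).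
Proof.
move=> p0 x y x0 xy; rewrite !powRN lef_pV2 ?posrE ?powR_gt0 //; last exact: lt_le_trans xy.
by rewrite ge0_ler_powR // nnegrE ltW // (lt_le_trans x0).
Qed.

Lemma convex_nondecreasing_powR (g p c : R) : 0 <= g -> 0 <= p ->
  convex_nondecreasing c (fun s => g * (c - s) `^ (- p))
                         (fun s => g * p * (c - s) `^ (- (p + 1))).
Proof.
move=> g0 p0; split.
- move=> s sc; have := is_derive_powR_reflect (- p) sc => d.
  by apply: is_derive_eq; rewrite /GRing.scale /= -opprD; ring.
- by move=> s _; rewrite !mulr_ge0 ?powR_ge0.
- move=> s s' ss' s'c; apply: ler_wpM2l; first exact: mulr_ge0.
  by apply: le_powR_neg; rewrite ?subr_gt0 ?addr_ge0 // lerD2l lerN2.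
Qed.

(** The derivative is [p] times a difference of powers [- (p + 1)], and the nearer singularity gives
    the larger power. *)
Lemma powR_neg_diff_nondecreasing p c c' : 0 <= p -> c <= c' ->
  forall s s', s <= s' -> s' < c ->
  (c - s) `^ (- p) - (c' - s) `^ (- p) <= (c - s') `^ (- p) - (c' - s') `^ (- p).
Proof.
move=> p0 cc' s s' ss' s'c.
have [d1 _ _] := convex_nondecreasing_powR c ler01 p0.
have [d2 _ _] := convex_nondecreasing_powR c' ler01 p0.
pose F c u := (c - u) `^ (- p).
have dF u : s <= u <= s' -> is_derive u 1 (fun u => F c u - F c' u)
   (p * (c - u) `^ (- (p + 1)) - p * (c' - u) `^ (- (p + 1))).
  move=> /andP[_ us']; have uc := le_lt_trans us' s'c.
  have := d1 u uc; have := d2 u (lt_le_trans uc cc').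
  have E x : (fun s => 1 * (x - s) `^ (- p)) = F x.
    by apply/funext => v; rewrite mul1r.
  by rewrite !mul1r !E => ? ?; apply: is_derive_eq.
have [x /andP[_ xs'] e] := mean_value ss' dF.
rewrite -subr_ge0 -/(F c s) -/(F c' s) -/(F c s') -/(F c' s') e -mulrBr.
have xc := le_lt_trans xs' s'c.
rewrite !mulr_ge0 // subr_ge0 //.
by apply: le_powR_neg; rewrite ?subr_gt0 ?addr_ge0 // lerD2r.
Qed.

(** Meant for [c] and [c'] at consecutive points t_{n-vs}; convexity is the preceding monotonicity
    with [p + 1] for [p]. *)
Lemma convex_nondecreasing_powR_diff (g p c c' : R) : 0 <= g -> 0 <= p -> c <= c' ->
  convex_nondecreasing c
    (fun s => g * (c - s) `^ (- p) - g * (c' - s) `^ (- p))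
    (fun s => g * p * (c - s) `^ (- (p + 1)) - g * p * (c' - s) `^ (- (p + 1))).
Proof.
move=> g0 p0 cc'.
have [d1 _ _] := convex_nondecreasing_powR c g0 p0.
have [d2 _ _] := convex_nondecreasing_powR c' g0 p0; split.
- move=> s sc; have := d1 s sc; have := d2 s (lt_le_trans sc cc') => ? ?.
  by apply: is_derive_eq.
- move=> s sc; rewrite -mulrBr; apply: mulr_ge0; first exact: mulr_ge0.
  rewrite subr_ge0; apply: le_powR_neg; rewrite ?subr_gt0 ?addr_ge0 // lerD2r //.
- move=> s s' ss' s'c; rewrite -!mulrBr; apply: ler_wpM2l; first exact: mulr_ge0.
  by apply: powR_neg_diff_nondecreasing; rewrite ?addr_ge0.
Qed.

Lemma integral_powR_reflect (p a b c : R) : p < 1 -> a < b -> b < c ->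
  (\int[mu]_(s in `[a, b]) ((c - s) `^ (- p))%:E =
   (((c - a) `^ (1 - p) - (c - b) `^ (1 - p)) / (1 - p))%:E)%E.
Proof.
move=> p1 ab bc; have p1' : 1 - p != 0 by rewrite subr_eq0 gt_eqF.
apply: etrans (@integral_FTC2 R a b (fun s => - (1 - p)^-1 * (c - s) `^ (1 - p))
  (fun s => (c - s) `^ (- p)) ab _ _) _; last by congr EFin; field.
- move=> s /andP[_ sb]; have := is_derive_powR_reflect (- p) (le_lt_trans sb bc).
  exact: is_derive_continuous.
- move=> s /andP[_ sb]; have := is_derive_powR_reflect (1 - p) (le_lt_trans sb bc) => d.
  apply: is_derive_eq; rewrite /GRing.scale /=.
  by rewrite (_ : 1 - p - 1 = - p); [field|ring].
Qed.

Lemma measurable_powR_reflect (p c : R) :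
  measurable_fun [set: R] (fun s : R => (c - s) `^ (- p)).
Proof.
apply: (measurableT_comp (measurable_powR (- p))).
exact: measurable_funB.
Qed.

(** The antiderivative settles intervals that stop short of [c]; monotone convergence along
    exhausting intervals reaches [c]. *)
Lemma integral_powR_singular (p c x : R) : 0 < p -> p < 1 -> 0 < x ->
  (\int[mu]_(s in `[(c - x)%R, c]) ((c - s) `^ (- p))%:E = (x `^ (1 - p) / (1 - p))%:E)%E.
Proof.
move=> p0 p1 x0; have q0 : 0 < 1 - p by rewrite subr_gt0.
pose f (s : R) : \bar R := ((c - s) `^ (- p))%R%:E.
have mg := measurable_powR_reflect p c.
(* The shift to [n.+2] keeps the interval nondegenerate at [n = 0]. *)
pose F n : set R := `[c - x, c - x / n.+2%:R]%classic.
have Fc : \bigcup_n F n = `[c - x, c[%classic.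
  apply/seteqP; split => s /=.
    move=> [n _]; rewrite /F /= !in_itv /= => /andP[-> sn] /=.
    by apply: le_lt_trans sn _; rewrite ltrBlDr ltrDl divr_gt0.
  rewrite in_itv /= => /andP[xs sc].
  have cs : 0 < c - s by rewrite subr_gt0.
  exists (Num.Def.trunc (x / (c - s))) => //; rewrite /F /= in_itv /= xs /=.
  rewrite lerBrDr addrC -lerBrDr ler_pdivrMr // mulrC -ler_pdivrMr //.
  apply: ltW; apply: lt_trans (truncnS_gt _) _.
  by rewrite ltr_nat.
have -> : (\int[mu]_(s in `[(c - x)%R, c]) f s = \int[mu]_(s in \bigcup_n F n) f s)%E.
  rewrite Fc integral_itv_bndo_bndc //.
  by apply/measurable_EFinP; exact: measurable_funTS.
have cvg1 : (\int[mu]_(s in F n) f s @[n --> \oo] -->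
    \int[mu]_(s in \bigcup_n F n) f s)%E.
  apply: ge0_nondecreasing_set_cvg_integral => //.
  - apply/nondecreasing_seqP => n; apply/subsetPset => s /=.
    rewrite /F /= !in_itv /= => /andP[-> /= sn]; apply: le_trans sn _.
    by rewrite lerD2l lerN2 ler_pM2l // lef_pV2 ?posrE // ler_nat.
  - by move=> i; exact: measurable_itv.
  - by move=> i; apply/measurable_EFinP; exact: measurable_funTS.
  - by move=> i s _; rewrite lee_fin powR_ge0.
apply: cvg_unique cvg1 _ => //=.
have -> : (fun n => \int[mu]_(s in F n) f s)%E =
    (fun n => ((x `^ (1 - p) - (x / n.+2%:R) `^ (1 - p)) / (1 - p))%:E).
  apply/funext => n; rewrite integral_powR_reflect // ?subKr //.
    rewrite ltrD2l ltrN2 ltr_pdivrMr // ltr_pMr // ltr1n //.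
  by rewrite ltrBlDr ltrDl divr_gt0.
apply: cvg_EFin; first by near=> n.
rewrite -[x `^ (1 - p) in X in _ --> X]subr0; apply: cvgMr_tmp; apply: cvgB; first exact: cvg_cst.
apply: ((cvg_at_rightP _ _ _).1 (powR_cvg0 q0) (fun n => x / n.+2%:R)).
split => [n|]; first by rewrite divr_gt0.
rewrite -[X in _ --> X](mulr0 x); apply: cvgMl_tmp.
by rewrite (cvg_shiftS (@harmonic R)); exact: cvg_harmonic.
Unshelve. all: by end_near. Qed.

Lemma Rintegral_powR_singular (g p c x : R) : 0 < p -> p < 1 -> 0 < x ->
  \int[mu]_(s in `[c - x, c]) (g * (c - s) `^ (- p)) = g * (x `^ (1 - p) / (1 - p)).
Proof.
move=> p0 p1 x0; have E := integral_powR_singular c p0 p1 x0.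
rewrite RintegralZl //; first by rewrite /Rintegral E.
apply/integrableP; split.
  by apply/measurable_EFinP; apply: measurable_funTS; exact: measurable_powR_reflect.
under eq_integral do rewrite /= ger0_norm ?powR_ge0 //.
by rewrite E ltry.
Qed.

(** The power [1 - p] is subadditive; the bound is the integral over an interval of the same length
    ending at the singularity. *)
Lemma Rintegral_powR_reflect_le (g p a b c : R) : 0 <= g -> p < 1 -> 0 <= p ->
  a < b -> b < c ->
  \int[mu]_(s in `[a, b]) (g * (c - s) `^ (- p)) <= g * ((b - a) `^ (1 - p) / (1 - p)).
Proof.
move=> g0 p1 p0 ab bc; have q0 : 0 < 1 - p by rewrite subr_gt0.
rewrite RintegralZl //; last first.
  apply: pointwise_continuous_integrable => s /andP[_ sb].
  exact: is_derive_continuous (is_derive_powR_reflect (- p) (le_lt_trans sb bc)).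
apply: ler_wpM2l => //; rewrite /Rintegral integral_powR_reflect //=.
rewrite ler_pM2r ?invr_gt0 // lerBlDr.
have x0 : 0 < b - a by rewrite subr_gt0.
have y0 : 0 < c - b by rewrite subr_gt0.
set x := b - a in x0 *; set y := c - b in y0 *.
have -> : c - a = x + y by rewrite /x /y; ring.
have z0 : 0 < x + y by exact: addr_gt0.
(* The fraction [u / (x + y)] is at most 1, so the power [1 - p <= 1] does not decrease it; the
   fractions of [x] and [y] add up to 1. *)
have split_le u : 0 < u -> u <= x + y -> u / (x + y) * (x + y) `^ (1 - p) <= u `^ (1 - p).
  move=> u0 ule; have {2}-> : u = u / (x + y) * (x + y) by rewrite divfK ?gt_eqF.
  have ux : 0 <= u / (x + y) by rewrite divr_ge0 // ltW.
  rewrite powRM ?(ltW z0) // ler_wpM2r ?powR_ge0 // ger1_powR //.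
    by rewrite divr_gt0 //= ler_pdivrMr ?mul1r.
  by rewrite gerBl.
have := lerD (split_le x x0 _) (split_le y y0 _).
rewrite -mulrDl -mulrDl divff ?gt_eqF // mul1r; apply.
  by rewrite lerDl ltW.
by rewrite lerDr ltW.
Qed.

End PowerKernel.

(** * Coefficients of the L2-1_sigma formula *)

Section Coefficients.
Variables (R : realType) (t : nat -> R).
Notation mu := (@lebesgue_measure R).
Implicit Types (G dG H dH : R -> R) (c : R).

(** [average] and [quad_corr] are the coefficients a (for [k < n]) and b as linear functionals of
    the kernel: the row [n] enters only through [G]. *)
Definition average k G : R :=
  (tau t k)^-1 * \int[mu]_(s in `[t k.-1, t k]) G s.

Definition quad_corr k G : R :=
  2 / (tau t k * (tau t k + tau t k.+1)) * moment (t k.-1) (t k) G.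

(* [B^(n)_(n-k)] for [k < n], with [G] in place of the kernel [omega (1 - alpha) (t_(n-vs) - s)]. *)
Definition history_coef k G : R :=
  if k == 1%N then average 1 G - quad_corr 1 G
  else average k G + quad_corr k.-1 G / tratio t k - quad_corr k G.

(** Cutting at [G (t k.-1)] leaves here the integrals over the [k]-th interval and in [tail_diff]
    those over earlier ones. The tail thus stays usable at [k = n], where the kernel is singular
    inside the last interval. *)
Definition head_diff k G : R := average k G - G (t k.-1) - quad_corr k G.

(* For [k = 1] the difference to split is [history_coef 1 G - 0], whence the value [G (t 0)]. *)
Definition tail_diff k G : R :=
  if k == 1%N then G (t 0%N)
  else G (t k.-1) - average k.-1 G + quad_corr k.-1 G / tratio t k
       + quad_corr k.-1 G - (if k == 2%N then 0 else quad_corr k.-2 G / tratio t k.-1).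

Lemma history_coef_diff k G : (0 < k)%N ->
  history_coef k G - (if k == 1%N then 0 else history_coef k.-1 G) =
  head_diff k G + tail_diff k G.
Proof.
case: k => // -[_|k _]; rewrite /history_coef /head_diff /tail_diff /=; first by ring.
by rewrite !eqSS; case: k => [|k] /=; ring.
Qed.

Lemma averageB k c c' G dG H dH : t k < c -> t k < c' ->
  convex_nondecreasing c G dG -> convex_nondecreasing c' H dH ->
  average k (fun s => G s - H s) = average k G - average k H.
Proof.
move=> tc tc' cG cH; rewrite /average -mulrBr RintegralB //.
- apply: pointwise_continuous_integrable.
  exact: (convex_nondecreasing_continuous cG).
- apply: pointwise_continuous_integrable.
  exact: (convex_nondecreasing_continuous cH).
Qed.

Lemma quad_corrB k c c' G dG H dH : t k < c -> t k < c' ->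
  convex_nondecreasing c G dG -> convex_nondecreasing c' H dH ->
  quad_corr k (fun s => G s - H s) = quad_corr k G - quad_corr k H.
Proof.
move=> tc tc' cG cH; rewrite /quad_corr -mulrBr /moment; congr (_ * _).
rewrite -RintegralB //; first by apply: eq_Rintegral => s _; rewrite mulrBr.
- apply: pointwise_continuous_integrable.
  exact: (moment_continuous cG).
- apply: pointwise_continuous_integrable.
  exact: (moment_continuous cH).
Qed.

Lemma average_le k c G dG : 0 < tau t k -> t k < c -> convex_nondecreasing c G dG ->
  average k G <= G (t k) - dG (t k.-1) * tau t k / 2.
Proof.
move=> tk tc cG; rewrite /average mulrC ler_pdivrMr //.
have := @Rintegral_convex_le R c G dG cG (t k.-1) (t k).
rewrite -subr_gt0 => /(_ tk tc) /le_trans; apply.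
by rewrite -/(tau t k); lra.
Qed.

Lemma quad_corr_ge0 k c G dG : 0 < tau t k -> 0 < tau t k.+1 -> t k < c ->
  convex_nondecreasing c G dG -> 0 <= quad_corr k G.
Proof.
move=> tk tk1 tc cG; apply: mulr_ge0.
  by apply: ltW; rewrite divr_gt0 // mulr_gt0 // addr_gt0.
by apply: (moment_ge0 cG) => //; rewrite -subr_gt0; exact: tk.
Qed.

Lemma quad_corr_le k c G dG : 0 < tau t k -> 0 < tau t k.+1 -> t k < c ->
  convex_nondecreasing c G dG ->
  quad_corr k G <= dG (t k) * tau t k ^+ 2 / (6 * (tau t k + tau t k.+1)).
Proof.
move=> tk tk1 tc cG; have tt := addr_gt0 tk tk1.
have := @moment_le R c G dG cG (t k.-1) (t k).
rewrite -subr_gt0 => /(_ tk tc) le.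
have c0 : 0 <= 2 / (tau t k * (tau t k + tau t k.+1)).
  by apply: ltW; rewrite divr_gt0 // mulr_gt0.
apply: le_trans (ler_wpM2l c0 le) _; rewrite -/(tau t k) le_eqVlt; apply/orP; left.
by apply/eqP; field; rewrite !gt_eqF.
Qed.

(** [quad_corr] takes at most the fraction tau_k / (tau_k + tau_{k+1}) of the nonnegative
    [average t k G - G (t k.-1)]. *)
Lemma head_diff_ge0 k c G dG : 0 < tau t k -> 0 < tau t k.+1 -> t k < c ->
  convex_nondecreasing c G dG -> 0 <= head_diff k G.
Proof.
move=> tk tk1 tc cG; have tt := addr_gt0 tk tk1.
have ab : t k.-1 < t k by rewrite -subr_gt0; exact: tk.
have le := moment_le_Rintegral cG ab tc.
have ge := Rintegral_nondecreasing_ge cG ab tc.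
rewrite /head_diff /average /quad_corr.
set I := Rintegral _ _ _ in le ge *; set m := moment _ _ _ in le *.
have tE : t k - t k.-1 = tau t k by [].
rewrite tE in le ge.
have c0 : 0 <= 2 / (tau t k * (tau t k + tau t k.+1)).
  by apply: ltW; rewrite divr_gt0 // mulr_gt0.
have {}le := ler_wpM2l c0 le.
rewrite subr_ge0; apply: le_trans le _.
rewrite -subr_ge0.
have -> : (tau t k)^-1 * I - G (t k.-1) - 2 / (tau t k * (tau t k + tau t k.+1)) *
   (tau t k / 2 * (I - tau t k * G (t k.-1))) =
   (I - tau t k * G (t k.-1)) * (tau t k.+1 / (tau t k * (tau t k + tau t k.+1))).
  by field; rewrite !gt_eqF.
by apply: mulr_ge0; rewrite ?subr_ge0 // ltW // divr_gt0 // mulr_gt0.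
Qed.

(* The subtracted moment over the third last interval is absorbed by half of the
   convexity gain over the second last one as soon as [1 <= 3 r^2 (1 + r)],
   i.e. for step ratios [r] above 0.4754. *)
Lemma tail_diff_ge0 k c G dG :
  (forall j, (1 <= j <= k)%N -> 0 < tau t j) ->
  (forall j, (2 <= j <= k)%N -> 4 / 7 <= tratio t j) ->
  (0 < k)%N -> t k.-1 < c -> (forall s, s < c -> 0 <= G s) ->
  convex_nondecreasing c G dG -> 0 <= tail_diff k G.
Proof.
move=> tpos ratio k0 tc G0 cG; rewrite /tail_diff; case: eqP => [k1|/eqP k1].
  by rewrite k1 /= in tc *; exact: G0.
case: k k0 k1 tc tpos ratio => [//|[//|k]] _ _ /= tc tpos ratio.
have t1 : 0 < tau t k.+1 by apply: tpos; rewrite /= leqnSn.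
have t2 : 0 < tau t k.+2 by apply: tpos; rewrite /= leqnn.
have avg := average_le t1 tc cG.
have q0 := quad_corr_ge0 t1 t2 tc cG.
have q1 : 0 <= quad_corr k.+1 G / tratio t k.+2.
  by apply: divr_ge0 => //; apply: ltW; rewrite divr_gt0.
have tkc : t k < c by apply: lt_trans tc; rewrite -subr_gt0; exact: t1.
have [_ dG0 _] := cG; have d0 := dG0 _ tkc.
set X := (X in _ - X).
(* The right side is the surplus that convexity leaves in [avg]. *)
suff : X <= dG (t k) * tau t k.+1 / 2 by rewrite /= in avg *; lra.
rewrite {}/X.
case: k avg q0 q1 tkc d0 t1 t2 tc tpos ratio => [|k] avg q0 q1 tkc d0 t1 t2 tc tpos ratio.
  by apply: divr_ge0 => //; apply: mulr_ge0 => //; exact: ltW.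
rewrite /=; have t3 : 0 < tau t k.+1 by apply: tpos; rewrite /= !ltnS ltnW.
have r3 : 4 / 7 <= tratio t k.+2 by apply: ratio; rewrite /= leqnSn.
have rE : tau t k.+2 = tratio t k.+2 * tau t k.+1.
  by rewrite /tratio divfK // gt_eqF.
have rpos : 0 < tratio t k.+2 by lra.
rewrite ler_pdivrMr //; apply: le_trans (quad_corr_le t3 t1 tkc cG) _.
move: (tratio t k.+2) (tau t k.+1) rE rpos r3 t3 => r x -> rpos r3 x0.
have den : 0 < 6 * (x + r * x) by rewrite mulr_gt0 // addr_gt0 // mulr_gt0.
rewrite ler_pdivrMr // -!mulrA; apply: ler_wpM2l => //.
(* The right side increases with [r] and equals 528/343 at [r = 4/7]. *)
have : 1 <= 3 * r ^+ 2 * (1 + r) by nra.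
rewrite -subr_ge0 => key; rewrite -subr_ge0.
rewrite [leRHS](_ : _ = x ^+ 2 * (3 * r ^+ 2 * (1 + r) - 1)); last by field.
by rewrite mulr_ge0 // sqr_ge0.
Qed.

Lemma head_diffB k c c' G dG H dH : t k < c -> t k < c' ->
  convex_nondecreasing c G dG -> convex_nondecreasing c' H dH ->
  head_diff k (fun s => G s - H s) = head_diff k G - head_diff k H.
Proof.
move=> tc tc' cG cH.
by rewrite /head_diff (averageB tc tc' cG cH) (quad_corrB tc tc' cG cH); ring.
Qed.

Lemma tail_diffB k c c' G dG H dH :
  (forall j, (j < k)%N -> t j < c) -> (forall j, (j < k)%N -> t j < c') ->
  (0 < k)%N -> convex_nondecreasing c G dG -> convex_nondecreasing c' H dH ->
  tail_diff k (fun s => G s - H s) = tail_diff k G - tail_diff k H.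
Proof.
move=> t1 t2 k0 cG cH; rewrite /tail_diff; case: eqP => // _.
have l1 : (k.-1 < k)%N by rewrite prednK.
have l2 : (k.-2 < k)%N by apply: leq_ltn_trans (leq_pred _) l1.
rewrite (averageB (t1 _ l1) (t2 _ l1) cG cH).
rewrite (quad_corrB (t1 _ l1) (t2 _ l1) cG cH).
rewrite (quad_corrB (t1 _ l2) (t2 _ l2) cG cH).
by case: ifP => _; ring.
Qed.

End Coefficients.

Lemma Gamma_ge0 (R : realType) (x : R) : 0 <= Gamma x.
Proof. by apply: Rintegral_ge0 => s _; rewrite mulr_ge0 ?powR_ge0 ?expR_ge0. Qed.

Lemma powR_1B (R : realType) (x p : R) : 0 < x -> x `^ (1 - p) = x * x `^ (- p).
Proof.
move=> x0; rewrite powRD ?powRr1 ?(ltW x0) //.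
by rewrite (gt_eqF x0) implybT.
Qed.

(** * Positivity of the quadratic form of the L2-1_sigma coefficients *)

Section Kernel.
Variables (R : realType) (alpha : R) (t : nat -> R) (N : nat).
Hypotheses (alpha_gt0 : 0 < alpha) (alpha_lt1 : alpha < 1).
Hypothesis tau_gt0 : forall k, (1 <= k <= N)%N -> 0 < tau t k.
Hypothesis ratio_ge : forall k, (2 <= k <= N)%N -> 4 / 7 <= tratio t k.
Notation mu := (@lebesgue_measure R).

Let sg_gt0 : 0 < 1 - alpha / 2. Proof. by move: alpha_gt0 alpha_lt1; lra. Qed.
Let sg_le1 : 1 - alpha / 2 <= 1. Proof. by move: alpha_gt0 alpha_lt1; lra. Qed.

Let g : R := (Gamma (1 - alpha))^-1.
Let g_ge0 : 0 <= g. Proof. by rewrite invr_ge0 Gamma_ge0. Qed.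

Let c n : R := tsig t (alpha / 2) n.
Let K n (s : R) : R := g * (c n - s) `^ (- alpha).

Let omegaE n s : omega (1 - alpha) (c n - s) = K n s.
Proof. by rewrite /omega /K mulrC (_ : 1 - alpha - 1 = - alpha) //; ring. Qed.

Let t_mono i j : (i <= j <= N)%N -> t i <= t j.
Proof.
elim: j => [|j IH] /andP[ij jN]; first by rewrite (_ : i = 0%N) //; lia.
have [->//|ij'] := eqVneq i j.+1.
apply: (@le_trans _ _ (t j)); first by apply: IH; lia.
by apply: ltW; rewrite -subr_gt0; apply: tau_gt0; lia.
Qed.

Let cE n : c n = t n.-1 + (1 - alpha / 2) * tau t n.
Proof. by rewrite /c /tsig /tau; ring. Qed.

Let c_gt n : (1 <= n <= N)%N -> t n.-1 < c n.
Proof.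
by move=> /tau_gt0 tn; rewrite cE ltrDl mulr_gt0.
Qed.

Let c_le n : (1 <= n <= N)%N -> c n <= t n.
Proof.
move=> /tau_gt0 tn; rewrite cE.
have -> : t n = t n.-1 + tau t n by rewrite /tau; ring.
by rewrite lerD2l ger_pMl.
Qed.

Let t_lt_c n k : (k < n <= N)%N -> t k < c n.
Proof.
by move=> kn; apply: le_lt_trans (c_gt _); [apply: t_mono|]; lia.
Qed.

Let c_mono n : (1 <= n)%N -> (n < N)%N -> c n <= c n.+1.
Proof.
move=> n0 nN; apply: le_trans (c_le _) _; first by lia.
by apply: ltW; apply: (c_gt (n := n.+1)); lia.
Qed.

Let dK n (s : R) : R := g * alpha * (c n - s) `^ (- (alpha + 1)).
Let K_convex n : convex_nondecreasing (c n) (K n) (dK n).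
Proof. exact: convex_nondecreasing_powR (ltW alpha_gt0). Qed.

Let K_ge0 n s : 0 <= K n s.
Proof. by rewrite mulr_ge0 ?powR_ge0. Qed.

Let KB_convex n : (1 <= n)%N -> (n < N)%N ->
  convex_nondecreasing (c n) (fun s => K n s - K n.+1 s) (fun s => dK n s - dK n.+1 s).
Proof.
move=> n0 nN.
exact: convex_nondecreasing_powR_diff (ltW alpha_gt0) (c_mono n0 nN).
Qed.

Let KB_ge0 n s : (1 <= n)%N -> (n < N)%N -> s < c n -> 0 <= K n s - K n.+1 s.
Proof.
move=> n0 nN sc; rewrite -mulrBr mulr_ge0 // subr_ge0.
by apply: le_powR_neg; rewrite ?(ltW alpha_gt0) ?subr_gt0 // lerD2r c_mono.
Qed.

Lemma acoefE n k : (1 <= k)%N -> (k < n <= N)%N -> acoef alpha t n k = average t k (K n).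
Proof.
move=> k0 kn; rewrite /acoef -/(c n) min_l; last by apply: ltW; exact: t_lt_c.
by congr (_ * _); apply: eq_Rintegral => s _; rewrite omegaE.
Qed.

Lemma bcoefE n k : bcoef alpha t n k = quad_corr t k (K n).
Proof.
by congr (_ * _); apply: eq_Rintegral => s _; rewrite -/(c n) omegaE /thalf.
Qed.

(** The offset 1 - alpha/2 makes [2 * acoef alpha t n n] equal to (2 - alpha)/(1 - alpha) times
    [K n (t n.-1)]; subtracting one copy leaves the factor 1/(1 - alpha). *)
Lemma acoef_diag n : (1 <= n <= N)%N ->
  2 * acoef alpha t n n - K n (t n.-1) =
  g * ((1 - alpha / 2) * tau t n) `^ (- alpha) / (1 - alpha).
Proof.
move=> nN; have tn := tau_gt0 nN; rewrite /acoef -/(c n) min_r; last exact: c_le.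
set x := (1 - alpha / 2) * tau t n.
have x0 : 0 < x by rewrite mulr_gt0.
have -> : t n.-1 = c n - x by rewrite cE /x; ring.
have -> : \int[mu]_(s in `[c n - x, c n]) omega (1 - alpha) (c n - s) =
    g * (x `^ (1 - alpha) / (1 - alpha)).
  rewrite -(Rintegral_powR_singular g (c n) alpha_gt0 alpha_lt1 x0).
  by apply: eq_Rintegral => s _; rewrite omegaE.
rewrite /K subKr powR_1B //.
by rewrite /x; field; rewrite subr_eq0 !gt_eqF.
Qed.

(** Column 0 is set to zero, the boundary value that summation by parts requires. *)
Let B n k : R := if k == 0%N then 0 else Bcoef alpha t n k.

Let kernel_diff_lt n a : (1 <= a)%N -> (a < n <= N)%N ->
  kernel_diff B n a = head_diff t a (K n) + tail_diff t a (K n).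
Proof.
move=> a0 an; have BE k : (1 <= k)%N -> (k < n)%N -> Bcoef alpha t n k = history_coef t k (K n).
  move=> k0 kn; rewrite /Bcoef /history_coef (ltn_eqF kn) (_ : n == 1%N = false); last lia.
  by case: eqP => [k1|_]; rewrite ?acoefE ?bcoefE //; lia.
rewrite /kernel_diff (_ : a == n = false); last by lia.
rewrite -history_coef_diff // /B (gtn_eqF a0) BE; [|lia|lia].
case: (eqVneq a 1%N) => [->//|a1]; rewrite (_ : a.-1 == 0%N = false); last lia.
by rewrite BE //; lia.
Qed.

(** For [n > 1] the gap is one copy of [quad_corr t n.-1 (K n) / tratio t n]: [2 * B n n] contains
    two, the tail only one. *)
Let kernel_diff_diag n : (1 <= n <= N)%N ->
  2 * acoef alpha t n n - K n (t n.-1) + tail_diff t n (K n) <= kernel_diff B n n.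
Proof.
move=> nN; rewrite /kernel_diff eqxx /B (_ : n == 0%N = false); last lia.
rewrite /Bcoef /tail_diff; case: (eqVneq n 1%N) => [->/=|n1].
  by rewrite subr0 subrK.
rewrite eqxx (_ : n.-1 == 0%N = false); last lia.
rewrite (_ : n.-1 == n = false); last lia.
have q0 : 0 <= quad_corr t n.-1 (K n) / tratio t n.
  rewrite divr_ge0 //; last by apply: ltW; rewrite divr_gt0 // tau_gt0 //; lia.
  apply: (quad_corr_ge0 _ _ _ (K_convex n)); rewrite ?tau_gt0 ?t_lt_c //; lia.
rewrite !bcoefE.
have [n2|n2] := eqVneq n 2%N.
  rewrite n2 /= (@acoefE 2 1) //; last by lia.
  by move: q0; rewrite n2 /=; lra.
rewrite (_ : n.-1 == 1%N = false); last lia.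
by rewrite (@acoefE n n.-1); [lra|lia|lia].
Qed.

Let kernel_diff_ge0 n a : (1 <= a <= n)%N -> (n <= N)%N -> 0 <= kernel_diff B n a.
Proof.
move=> an nN.
have tl : 0 <= tail_diff t a (K n).
  apply: (tail_diff_ge0 (c := c n) (dG := dK n)) => //.
  - by move=> j jN; apply: tau_gt0; lia.
  - by move=> j jN; apply: ratio_ge; lia.
  - by lia.
  - by apply: t_lt_c; lia.
have [an'|an'] := ltnP a n.
  rewrite kernel_diff_lt; [|lia|lia]; apply: addr_ge0 => //.
  by apply: (head_diff_ge0 (c := c n) (dG := dK n)); rewrite ?tau_gt0 ?t_lt_c //; lia.
have ean : a = n by lia.
subst a; apply: le_trans (kernel_diff_diag _); last by lia.
apply: addr_ge0 => //; rewrite acoef_diag; last lia.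
by rewrite divr_ge0 ?mulr_ge0 ?powR_ge0 // subr_ge0 ltW.
Qed.

(** By linearity, heads and tails are compared through their values at [K n - K n.+1]; for [a = n]
    the head of row [n.+1] faces the diagonal value instead. *)
Let kernel_diff_antitone n a : (1 <= a <= n)%N -> (n < N)%N ->
  kernel_diff B n.+1 a <= kernel_diff B n a.
Proof.
move=> an nN; have n0 : (1 <= n)%N by lia.
have tl : 0 <= tail_diff t a (K n) - tail_diff t a (K n.+1).
  have t1 j : (j < a)%N -> t j < c n by move=> ?; apply: t_lt_c; lia.
  have t2 j : (j < a)%N -> t j < c n.+1 by move=> ?; apply: t_lt_c; lia.
  have a0 : (0 < a)%N by lia.
  rewrite -(tail_diffB t1 t2 a0 (K_convex n) (K_convex n.+1)).
  apply: (tail_diff_ge0 (c := c n) (dG := fun s => dK n s - dK n.+1 s)).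
  - by move=> j jN; apply: tau_gt0; lia.
  - by move=> j jN; apply: ratio_ge; lia.
  - by lia.
  - by apply: t_lt_c; lia.
  - by move=> s; exact: KB_ge0.
  - exact: KB_convex.
rewrite [leLHS]kernel_diff_lt; [|lia|lia].
have [an'|an'] := ltnP a n.
  rewrite kernel_diff_lt; [|lia|lia].
  apply: lerD; last by rewrite -subr_ge0.
  have : 0 <= head_diff t a (K n) - head_diff t a (K n.+1); last by rewrite subr_ge0.
  have t1 : t a < c n by apply: t_lt_c; lia.
  have t2 : t a < c n.+1 by apply: t_lt_c; lia.
  rewrite -(head_diffB t1 t2 (K_convex n) (K_convex n.+1)).
  apply: (head_diff_ge0 (c := c n) (dG := fun s => dK n s - dK n.+1 s)) => //.
  - by apply: tau_gt0; lia.
  - by apply: tau_gt0; lia.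
  - exact: KB_convex.
have ean : a = n by lia.
subst a; apply: le_trans (kernel_diff_diag _); last by lia.
have nN' : (1 <= n <= N)%N by lia.
have tn := tau_gt0 nN'.
have tn1 : 0 < tau t n.+1 by apply: tau_gt0; lia.
have tc : t n < c n.+1 by apply: t_lt_c; lia.
have ab : t n.-1 < t n by rewrite -subr_gt0; exact: tn.
(* The head is at most the average of [K n.+1], hence at most g tau_n^(-alpha) / (1 - alpha); the
   diagonal value has the shorter length (1 - alpha/2) tau_n under the same negative power. *)
have : head_diff t n (K n.+1) <= 2 * acoef alpha t n n - K n (t n.-1).
  rewrite acoef_diag //; have := quad_corr_ge0 tn tn1 tc (K_convex n.+1).
  have := K_ge0 n.+1 (t n.-1) => k0 q0.
  apply: (@le_trans _ _ (average t n (K n.+1))).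
    by rewrite /head_diff -addrA gerDl -opprD oppr_le0 addr_ge0.
  rewrite /average mulrC ler_pdivrMr //.
  apply: le_trans (Rintegral_powR_reflect_le g_ge0 alpha_lt1 (ltW alpha_gt0) ab tc) _.
  rewrite -/(tau t n) [leLHS]mulrA [leRHS]mulrAC; apply: ler_wpM2r.
    by rewrite invr_ge0 subr_ge0 ltW.
  rewrite -[leRHS]mulrA; apply: ler_wpM2l => //.
  rewrite powR_1B // mulrC.
  apply: ler_wpM2r; first exact: ltW.
  apply: le_powR_neg; rewrite ?(ltW alpha_gt0) //.
    by rewrite mulr_gt0.
  by rewrite ger_pMl.
move=> le; apply: lerD; first exact: le.
by rewrite -subr_ge0; exact: tl.
Qed.

Lemma Bcoef_form_ge0 (x : nat -> R) n : (n <= N)%N ->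
  0 <= \sum_(1 <= l < n.+1) (\sum_(1 <= k < l.+1) Bcoef alpha t l k * x k) * x l.
Proof.
move=> nN; have := @kernel_form_ge0 R B x N (fun=> erefl) kernel_diff_ge0
  kernel_diff_antitone n nN.
congr (_ <= _); apply: eq_bigr => l _; congr (_ * _).
by apply: eq_big_nat => k /andP[k0 _]; rewrite /B gtn_eqF.
Qed.

End Kernel.

(** * Energy stability of the unbalanced scheme *)

Theorem mainTheorem11 (R : realType) (L m eps alpha kappa beta K1 : R)
  (M N : nat) (nl : nonlin R) (V : R -> R) (t : nat -> R)
  (phi : nat -> grid R) (Rv : nat -> R) (ph1 : grid R) :
  let vs := alpha / 2 in
  let h := L / M%:R in
  (* constants *)
  0 < L -> (0 < M)%N -> 0 < m -> 0 < eps -> 0 < alpha -> alpha < 1 ->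
  0 <= kappa -> nonlin_ok nl beta ->
  (* (A1) *)
  (forall x, derivable V x 1) -> continuous (derive1 V) ->
  (exists C : R, forall x y, `|derive1 V x - derive1 V y| <= C * `|x - y|) ->
  V 1 = 1 -> derive1 V 1 = 0 -> (forall x, `|derive1 V x| <= K1) ->
  (* (A2) with K2 = 1 *)
  (forall x, 0 <= V x <= 1) ->
  (* (A3) *)
  (forall z1 z2, `|z1 - 1| <= `|z2 - 1| -> `|V z1 - 1| <= `|V z2 - 1|) ->
  (* time grid *)
  t 0%N = 0 -> (forall k, (1 <= k <= N)%N -> t k.-1 < t k) ->
  (forall k, (2 <= k <= N)%N -> 4 / 7 <= tratio t k) ->
  (* stabilization constant *)
  (forall x, - beta <= x <= beta -> `|derive1 (fnl nl) x| <= kappa) ->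
  (* initial data and grid functions *)
  (forall n, grid_periodic M (phi n)) -> grid_periodic M ph1 ->
  supn M (phi 0%N) <= beta ->
  (* restriction on the first step only *)
  tau t 1 <= Num.min
     ((4 / (11 * vs * m * (kappa + 4 * eps ^+ 2 / h ^+ 2) * Gamma (2 - alpha)))
        `^ (alpha^-1))
     ((4 / (11 * kappa * (1 - vs) * m * Gamma (2 - alpha))) `^ (alpha^-1)) ->
  (* first-step predictor hat phi^1 *)
  supn M ph1 <= beta ->
  (let phs1 := gcomb (1 - vs) ph1 vs (phi 0%N) in
   forall i j, Bcoef alpha t 1 1 * (ph1 i j - phi 0%N i j)
               = m * (eps ^+ 2 * lap h phs1 i j + fnl nl (phs1 i j))) ->
  (* the scheme *)
  (forall n, (1 <= n <= N)%N ->
     let ph := phihat t beta phi ph1 n in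
     let phs := gcomb (1 - vs) ph vs (phi n.-1) in
     let ps := gcomb (1 - vs) (phi n) vs (phi n.-1) in
     let Vs := V (gh nl M h phs (Rv n.-1)) in
     let Dphi : grid R := fun i j => (phi n i j - phi n.-1 i j) / tau t n in
     (forall i j, Dfrac alpha t phi n i j
        = m * (eps ^+ 2 * lap h ps i j + Vs * fnl nl (phs i j)
               - kappa * (ps i j - Vs * phs i j))) /\
     (Rv n - Rv n.-1) / tau t n
        = - Vs * ip M h (gmap (fnl nl) phs) Dphi
          + kappa * ip M h (gcomb 1 ps (- Vs) phs) Dphi) ->
  (* energy stability *)
  forall n, (1 <= n <= N)%N ->
    energy M h eps (phi n) (Rv n) <= energy M h eps (phi 0%N) (Rv 0%N).
Proof.
move=> vs h L0 M0 m0 eps0 alpha0 alpha1 _ _ _ _ _ _ _ _ _ _ _ t_lt ratio _ phi_per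
  _ _ _ _ _ scheme n /andP[_ nN].
have tau0 k : (1 <= k <= N)%N -> 0 < tau t k by move=> /t_lt; rewrite /tau subr_gt0.
(* [Dfrac] unfolds to the row sum of [Bcoef], and [phihat] covers the first step as well as the
   later ones. *)
apply: (@energy_le_of_form_ge0 R M N h m eps vs kappa t phi
  (fun n => gcomb (1 - vs) (phihat t beta phi ph1 n) vs (phi n.-1))
  (fun n => V (gh nl M h (gcomb (1 - vs) (phihat t beta phi ph1 n) vs (phi n.-1))
                 (Rv n.-1)))
  Rv (fnl nl) (Bcoef alpha t)) => //.
- by rewrite /vs ler_pM2r ?invr_gt0 // ltW.
- by move=> k /tau0 tk; rewrite gt_eqF.
- by move=> x k kN; apply: (@Bcoef_form_ge0 R alpha t N).
Qed.
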